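(* Let $n\ge 0$ and let $S^n=\{x\in\mathbb R^{n+1}:\|x\|=1\}$ be the unit sphere of the Euclidean space $\mathbb R^{n+1}$, with the natural action of the group $\mathsf{SO}(n+1)$ of orientation-preserving linear isometries of $\mathbb R^{n+1}$. Then $S^n$ admits an $\mathsf{SO}(n+1)$-invariant binary closed $k$-network (i.e. $S^n$ is $\mathsf{SO}(n+1)$-supercompact) if and only if $n\le 1$.
   Context: A family $\mathcal A$ of sets is linked if $A\cap B\neq\emptyset$ for all $A,B\in\mathcal A$; centered if every finite subfamily has nonempty intersection; binary if every linked subfamily of $\mathcal A$ is centered. A family $\mathcal N$ of closed subsets of a topological space $X$ is a closed $k$-network if for every open $U\subset X$ and every compact $K\subset U$ there is a finite $\mathcal F\subset\mathcal N$ with $K\subset\bigcup\mathcal F\subset U$. If a group $G$ acts on $X$, a family $\mathcal F$ of subsets of $X$ is $G$-invariant if $gF\in\mathcal F$ for all $F\in\mathcal F$, $g\in G$. A compact $G$-space is $G$-supercompact if it admits a $G$-invariant binary closed $k$-network. *)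

(* Defs.v *)
From HB Require Import structures.
From mathcomp Require Import all_boot all_order all_algebra.
From mathcomp Require Import all_classical all_reals all_analysis.
Unset Printing Implicit Defensive.
Import Order.TTheory GRing.Theory Num.Theory.
Import numFieldNormedType.Exports.
Local Open Scope classical_set_scope.
Local Open Scope ring_scope.

Definition linked {T : Type} (A : set (set T)) : Prop :=
  forall B C, A B -> A C -> B `&` C !=set0.

Definition centered {T : Type} (A : set (set T)) : Prop :=
  forall F : set (set T), finite_set F -> F `<=` A -> \bigcap_(B in F) B !=set0.

Definition binary {T : Type} (A : set (set T)) : Prop :=
  forall L : set (set T), L `<=` A -> linked L -> centered L.

Definition closed_knetwork {X : topologicalType} (N : set (set X)) : Prop :=
  (forall F, N F -> closed F) /\
  (forall (U K : set X), open U -> compact K -> K `<=` U ->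
     exists Fm : set (set X), [/\ finite_set Fm, Fm `<=` N,
        K `<=` \bigcup_(F in Fm) F & \bigcup_(F in Fm) F `<=` U]).

Definition sphere (R : realType) (n : nat) : set 'rV[R]_(n.+1) :=
  [set x | \sum_(i < n.+1) (x ord0 i) ^+ 2 = 1].

Definition SO (R : realType) (m : nat) : set 'M[R]_m :=
  [set M | M *m M^T = 1%:M /\ \det M = 1].

(* linear action of M on a row vector x: corresponds to the column vector M x *)
Definition lin_act (R : realType) (m : nat) (M : 'M[R]_m) (x : 'rV[R]_m) : 'rV[R]_m :=
  x *m M^T.

(* The sphere as a topological space with the subspace topology *)
Definition Sph (R : realType) (n : nat) : topologicalType := (set_type (sphere R n) : topologicalType).

Definition sph_image (R : realType) (n : nat) (M : 'M[R]_(n.+1)) (F : set (Sph R n))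
  : set (Sph R n) :=
  [set y | exists2 x, F x & set_val y = lin_act R (n.+1) M (set_val x)].

Definition SO_invariant (R : realType) (n : nat) (N : set (set (Sph R n))) : Prop :=
  forall M F, SO R n.+1 M -> N F -> N (sph_image R n M F).

Definition SO_supercompact (R : realType) (n : nat) : Prop :=
  exists N : set (set (Sph R n)), [/\ SO_invariant R n N, binary N & closed_knetwork N].

(* Main.v *)
Require Import Defs.
From HB Require Import structures.
From mathcomp Require Import all_boot all_order all_algebra.
From mathcomp Require Import all_classical all_reals all_analysis.
From mathcomp Require Import finmap ring lra.
Import Order.TTheory GRing.Theory Num.Theory.
Import numFieldNormedType.Exports.
Local Open Scope classical_set_scope.
Local Open Scope ring_scope.

(** For [n <= 1] the closed caps of small radius work: on a half-circle they are
    intervals, and intervals of a line satisfy Helly's theorem with number 2.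

    For [n >= 2] an invariant closed k-network contains a set [F] with at least
    two points inside a small cap. If a rotation [g] of order 3 satisfies
    [F `&` g F !=set0], then [F], [g F], [g^2 F] are linked, so binarity yields
    a point [q] with [q], [g q], [g^2 q] all in [F]. The sum of these three
    points lies on the fixed space of [g]. One chooses [p], [p'] in [F] that
    (almost) span an edge of the convex cone over [F], and [g] with [g p = p']
    whose axis lies on the outer side of a supporting hyperplane at that edge;
    the sum is then separated from [F] by this hyperplane, a contradiction. *)

(** * Dot product of row vectors *)

Definition dot (R : realType) (n : nat) (x y : 'rV[R]_n) : R := (x *m y^T) ord0 ord0.
Arguments dot {R n} x y.

Section Dot.
Context {R : realType} {n : nat}.
Implicit Types x y z : 'rV[R]_n.

Lemma dotE x y : dot x y = \sum_i x ord0 i * y ord0 i.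
Proof. by rewrite /dot mxE; apply: eq_bigr => i _; rewrite mxE. Qed.

Lemma dotC x y : dot x y = dot y x.
Proof. by rewrite !dotE; apply: eq_bigr => i _; rewrite mulrC. Qed.

Lemma dotDl x y z : dot (x + y) z = dot x z + dot y z.
Proof. by rewrite /dot mulmxDl mxE. Qed.

Lemma dotZl (k : R) x z : dot (k *: x) z = k * dot x z.
Proof. by rewrite /dot -scalemxAl mxE. Qed.

Lemma dotNl x z : dot (- x) z = - dot x z.
Proof. by rewrite -scaleN1r dotZl mulN1r. Qed.

Lemma dotDr x y z : dot x (y + z) = dot x y + dot x z.
Proof. by rewrite dotC dotDl !(dotC x). Qed.

Lemma dotZr (k : R) x z : dot x (k *: z) = k * dot x z.
Proof. by rewrite dotC dotZl dotC. Qed.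

Lemma dotNr x z : dot x (- z) = - dot x z.
Proof. by rewrite dotC dotNl dotC. Qed.

Definition dot_lin := (dotDl, dotDr, dotNl, dotNr, dotZl, dotZr).

Lemma dot_delta (i : 'I_n) (q : 'rV[R]_n) : dot (delta_mx ord0 i) q = q ord0 i.
Proof. by rewrite /dot -rowE !mxE. Qed.

Lemma dotxx x : dot x x = \sum_i x ord0 i ^+ 2.
Proof. by rewrite dotE; apply: eq_bigr => i _; rewrite expr2. Qed.

Lemma dotxx_ge0 x : 0 <= dot x x.
Proof. by rewrite dotxx; apply: sumr_ge0 => i _; apply: sqr_ge0. Qed.

Lemma sqr_coord_le x i : x ord0 i ^+ 2 <= dot x x.
Proof.
by rewrite dotxx (bigD1 i) //= lerDl; apply: sumr_ge0 => j _; apply: sqr_ge0.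
Qed.

Lemma dotxx_eq0 x : dot x x = 0 -> x = 0.
Proof.
move=> x0; apply/rowP => i; rewrite mxE; apply/eqP.
by rewrite -sqrf_eq0 eq_le sqr_ge0 andbT -x0 sqr_coord_le.
Qed.

(** The squared length of [dot y y *: x - dot x y *: y] is [dot y y] times the difference of the two
    sides. *)
Lemma dot_CauchySchwarz x y : dot x y ^+ 2 <= dot x x * dot y y.
Proof.
have [y0|y0] := eqVneq (dot y y) 0.
  by rewrite y0 mulr0 (dotxx_eq0 y y0) /dot trmx0 mulmx0 mxE expr0n.
have := dotxx_ge0 (dot y y *: x - dot x y *: y).
rewrite !dot_lin (dotC y x).
have : 0 < dot y y by rewrite lt_def y0 dotxx_ge0.
set a := dot x x; set b := dot x y; set c := dot y y => c0 h.
have : 0 <= c * (a * c - b ^+ 2) by move: h; congr (_ <= _); ring.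
by rewrite pmulr_rge0 // subr_ge0.
Qed.

Lemma mulmx_dot x y z : x *m (y^T *m z) = dot x y *: z.
Proof.
by rewrite mulmxA [x *m y^T]mx11_scalar mul_scalar_mx.
Qed.

(** * Reflections and rotations of order 3 *)

Definition householder (w : 'rV[R]_n) : 'M[R]_n := 1%:M - 2%:R *: (w^T *m w).

Lemma mul_householder x w : x *m householder w = x - (2%:R * dot x w) *: w.
Proof. by rewrite mulmxBr mulmx1 -scalemxAr mulmx_dot scalerA. Qed.

Lemma tr_householder w : (householder w)^T = householder w.
Proof. by rewrite /householder linearB /= linearZ /= trmx_mul trmxK trmx1. Qed.

Lemma householderK w : dot w w = 1 -> householder w *m householder w = 1%:M.
Proof.
move=> w1; apply/row_matrixP => i; rewrite 2!rowE mulmxA mulmx1 !mul_householder.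
set x := delta_mx _ _; rewrite !dot_lin w1.
by apply/rowP => j; rewrite !mxE; ring.
Qed.

(* Two mirrors at angle 60 degrees compose to a rotation of order 3. *)
Section Rotation.
Context (f w : 'rV[R]_n).
Context (f1 : dot f f = 1) (w1 : dot w w = 1) (fw : dot f w = 2%:R^-1).

(** Row vectors are multiplied on the right, so the mirror of [w] acts first, and the matrix
    performing this rotation through [lin_act] is [G^T]. *)
Let G := householder w *m householder f.

Lemma mul_rot x : x *m G =
  x - (2%:R * dot x w) *: w - (2%:R * (dot x f - dot x w)) *: f.
Proof.
rewrite mulmxA !mul_householder !dot_lin (dotC w f) fw.
by apply/rowP => j; rewrite !mxE; field.
Qed.

(** [G] acts on the pair [(dot x f, dot x w)] by [(a, b) |-> (b - a, - a)], a map of order 3 whose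
    orbits have sum zero. The order of [G] and its orbit sums are read off from this. *)
Lemma dot_rot_f x : dot (x *m G) f = dot x w - dot x f.
Proof. by rewrite mul_rot !dot_lin f1 (dotC w f) fw; field. Qed.

Lemma dot_rot_w x : dot (x *m G) w = - dot x f.
Proof. by rewrite mul_rot !dot_lin w1 fw; field. Qed.

Lemma rot_order3 : G *m G *m G = 1%:M.
Proof.
apply/row_matrixP => i; rewrite 2!rowE 2!mulmxA mulmx1.
set x := delta_mx _ _; rewrite mul_rot !(dot_rot_f, dot_rot_w).
rewrite mul_rot !(dot_rot_f, dot_rot_w) mul_rot.
by apply/rowP => j; rewrite !mxE; ring.
Qed.

Lemma rot_SO : SO R n G^T.
Proof.
have GT : G^T *m G = 1%:M.
  by rewrite trmx_mul !tr_householder mulmxA -(mulmxA (householder f)) householderK // mulmx1 householderK.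
split; first by rewrite trmxK.
(* The determinant of a matrix of order 3 is a real cube root of 1. *)
rewrite det_tr; have := congr1 determinant rot_order3.
rewrite (det_mulmx (G *m G)) (det_mulmx G) det1; set d := \det G => d3.
have : (d - 1) * ((d + 2%:R^-1) ^+ 2 + 3%:R / 4%:R) = 0.
  by rewrite -[RHS](subrr 1) -[X in _ = X - _]d3; field.
move/eqP; rewrite mulf_eq0 subr_eq0 => /orP[/eqP //|/eqP dp].
by have := sqr_ge0 (d + 2%:R^-1); lra.
Qed.

Lemma rot_sum x c : dot c f = 0 -> dot c w = 0 ->
  [/\ dot f (x + x *m G + x *m G *m G) = 0, dot w (x + x *m G + x *m G *m G) = 0
    & dot c (x + x *m G + x *m G *m G) = 3%:R * dot c x].
Proof.
move=> cf cw; have dc y : dot c (y *m G) = dot c y.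
  by rewrite mul_rot !dot_lin cf cw; ring.
split; rewrite !dotDr ?dc; last by ring.
  by rewrite !(dotC f) !(dot_rot_f, dot_rot_w); ring.
by rewrite !(dotC w) !(dot_rot_f, dot_rot_w); ring.
Qed.

End Rotation.
End Dot.

(** * Choice of the rotation carrying [p] to [p'] *)

Section Turn.
Context {R : realType} {n : nat}.

Lemma dot_eq1 (p q : 'rV[R]_n) : dot p p = 1 -> dot q q = 1 -> 1 <= dot p q -> p = q.
Proof.
move=> p1 q1 pq; apply/eqP; rewrite -subr_eq0; apply/eqP/dotxx_eq0.
have := dotxx_ge0 (p - q); rewrite !dot_lin p1 q1 (dotC q p); lra.
Qed.

Lemma sqr_lt_pos (s t : R) : 0 < s -> t ^+ 2 < s ^+ 2 -> 0 < s + t.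
Proof. by move=> s0 ts; nra. Qed.

(* If [u] nearly vanishes on the edge [p p'], compared to its length, then the
   axis of the rotation can be chosen on the positive side of [u]. The vector
   [q + q G + q G^2] is three times the projection of [q] to the fixed space of
   [G], so [u] is positive on it. *)
Lemma triangle_rotation (p p' u : 'rV[R]_n) :
  dot p p = 1 -> dot p' p' = 1 -> p != p' -> 2%:R^-1 <= dot p p' ->
  dot u p = 0 -> dot u p' ^+ 2 <= (1 - dot p p') / 8%:R -> 1 <= dot u u ->
  exists G : 'M[R]_n, [/\ SO R n G^T, G *m G *m G = 1%:M, p *m G = p' &
    forall q, dot q q = 1 -> 2%:R^-1 <= dot p q -> 2%:R^-1 <= dot p' q ->
      0 < dot u (q + q *m G + q *m G *m G)].
Proof.
move=> p1 p'1 pp' k2 up up' u1.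
have k1 : dot p p' < 1.
  by rewrite ltNge; apply/negP => /(dot_eq1 _ _ p1 p'1)/eqP; apply/negP.
(* Cosine and sine of half the angle between [p] and [p']. *)
pose a := Num.sqrt ((1 + dot p p') / 2%:R).
pose b := Num.sqrt ((1 - dot p p') / 2%:R).
have a2 : dot p p' = 2%:R * a ^+ 2 - 1 by rewrite sqr_sqrtr; [field|lra].
have b2 : dot p p' = 1 - 2%:R * b ^+ 2 by rewrite sqr_sqrtr; [field|lra].
have a0 : 0 < a by rewrite sqrtr_gt0; lra.
have b0 : 0 < b by rewrite sqrtr_gt0; lra.
have a_neq0 := lt0r_neq0 a0; have b_neq0 := lt0r_neq0 b0.
clearbody a b.
(* The unit vectors [m] along the bisector and [f] along the chord form an orthonormal basis of the
   plane of [p] and [p']. *)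
pose m := (2%:R * a)^-1 *: (p + p').
pose f := (2%:R * b)^-1 *: (p' - p).
have mm : dot m m = 1.
  by rewrite !dot_lin p1 p'1 (dotC p' p) a2; field.
have ff : dot f f = 1.
  by rewrite !dot_lin p1 p'1 (dotC p' p) b2; field.
have mf : dot m f = 0.
  by rewrite !dot_lin p1 p'1 (dotC p' p); field; rewrite a_neq0 b_neq0.
pose mu := dot u m; pose phi := dot u f.
(* Since [dot u p = 0], both [2 a mu] and [2 b phi] equal [dot u p'], whose square is at most
   [b ^+ 2 / 4]. *)
have mu2 : (2%:R * a * mu) ^+ 2 <= b ^+ 2 / 4%:R.
  rewrite /mu !dot_lin up add0r mulrA divff ?mul1r; first lra.
  by rewrite mulf_neq0 ?pnatr_eq0.
have phi2 : phi ^+ 2 <= 16%:R^-1.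
  have : (2%:R * b * phi) ^+ 2 <= b ^+ 2 / 4%:R.
    rewrite /phi !dot_lin up oppr0 addr0 mulrA divff ?mul1r; first lra.
    by rewrite mulf_neq0 ?pnatr_eq0.
  have : 0 < b ^+ 2 by rewrite exprn_gt0.
  move=> bb h; have : b ^+ 2 * (phi ^+ 2) <= b ^+ 2 * 16%:R^-1 by nra.
  by rewrite ler_pM2l.
have pE : p = a *: m - b *: f.
  by apply/rowP => j; rewrite !mxE; field; rewrite a_neq0 b_neq0.
have p'E : p' = a *: m + b *: f.
  by apply/rowP => j; rewrite !mxE; field; rewrite a_neq0 b_neq0.
have muE : dot u m = mu by [].
have phiE : dot u f = phi by [].
clearbody mu phi m f.
(* This value is forced by [dot p w = 0] for the [w] below. *)
pose x := b / (2%:R * a).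
have x0 : 0 < x by rewrite divr_gt0 ?mulr_gt0 ?ltr0n.
have bx : b = 2%:R * a * x by rewrite /x; field.
clearbody x.
have x12 : x ^+ 2 <= 12%:R^-1.
  have : 12%:R * x ^+ 2 * (a ^+ 2) <= a ^+ 2.
    have : b ^+ 2 = 4%:R * a ^+ 2 * x ^+ 2 by rewrite bx; ring.
    nra.
  rewrite -[X in _ <= X]mul1r ler_pM2r ?exprn_gt0 //; lra.
have mux : mu ^+ 2 <= x ^+ 2 / 4%:R.
  have aa : 0 < 4%:R * a ^+ 2 by rewrite mulr_gt0 ?exprn_gt0.
  by rewrite -(ler_pM2l aa); move: mu2; rewrite bx; lra.
pose r := u - mu *: m - phi *: f.
have rr : dot r r = dot u u - mu ^+ 2 - phi ^+ 2.
  rewrite /r !dot_lin mm ff (dotC f m) mf (dotC m u) (dotC f u) muE phiE; ring.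
have rm : dot r m = 0.
  by rewrite /r !dot_lin mm (dotC f m) mf muE; ring.
have rf : dot r f = 0.
  by rewrite /r !dot_lin ff mf phiE; ring.
have rE : u = mu *: m + phi *: f + r by apply/rowP => j; rewrite !mxE; ring.
clearbody r.
pose E := Num.sqrt (dot r r).
have E2 : E ^+ 2 = dot u u - mu ^+ 2 - phi ^+ 2.
  by rewrite sqr_sqrtr ?dotxx_ge0 ?rr.
have E0 : 0 < E by rewrite sqrtr_gt0 rr; lra.
clearbody E.
have E_neq0 := lt0r_neq0 E0.
(* The sign gives [u] the component [- E] along [e], so that the axis [c] below leans towards
   [u]. *)
pose e := - (E^-1 *: r).
have ee : dot e e = 1.
  by rewrite !dot_lin rr -E2; field.
have em : dot e m = 0 by rewrite !dot_lin rm; ring.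
have ef : dot e f = 0 by rewrite !dot_lin rf; ring.
have uE : u = mu *: m + phi *: f - E *: e.
  by rewrite /e scalerN opprK scalerA divff // scale1r.
clearbody e.
(* Chosen to make [w] a unit vector: [1/4 + x ^+ 2 + y ^+ 2 = 1]. *)
pose y := Num.sqrt (3%:R / 4%:R - x ^+ 2).
have y2 : y ^+ 2 = 3%:R / 4%:R - x ^+ 2 by rewrite sqr_sqrtr //; lra.
have y0 : 0 < y by rewrite sqrtr_gt0; lra.
(* [w] is orthogonal to [p], so the mirror of [w] fixes [p], and the mirror of
   [f] swaps [p] and [p']; [c] spans the axis inside the span of [m, f, e]. *)
pose w := 2%:R^-1 *: f + x *: m + y *: e.
pose c := y *: m - x *: e.
have ww : dot w w = 1.
  rewrite !dot_lin mm ff ee em ef mf (dotC f m) (dotC f e) (dotC m e) em ef mf.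
  transitivity (4%:R^-1 + x ^+ 2 + y ^+ 2); first by field.
  by rewrite y2; field.
have fw : dot f w = 2%:R^-1.
  by rewrite !dot_lin ff (dotC f m) (dotC f e) ef mf; ring.
have cf : dot c f = 0 by rewrite !dot_lin mf ef; ring.
have cw : dot c w = 0.
  rewrite !dot_lin mm ee mf ef em (dotC m e) em; ring.
pose G := householder w *m householder f.
have pw : dot p w = 0.
  rewrite pE !dot_lin mf mm ff (dotC f m) mf (dotC m e) em (dotC f e) ef.
  by rewrite bx; field.
have pf : dot p f = - b by rewrite pE !dot_lin mf ff; ring.
exists G; split.
- exact: rot_SO.
- exact: rot_order3.
- rewrite (mul_rot f w fw) pw pf p'E pE.
  by apply/rowP => j; rewrite !mxE; ring.
move=> q qq pq p'q.
have [fS wS cS] := rot_sum f w ff ww fw q c cf cw.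
(* This is [dot u c / dot c c], with [dot c c = x ^+ 2 + y ^+ 2 = 3/4]. The [f] and [w] parts of [u]
   vanish on the orbit sum, which leaves [gamma * (3 * dot c q)]. *)
pose gamma := 4%:R / 3%:R * (mu * y + E * x).
have uE' : u = (phi - 2%:R / 3%:R * (mu * x - E * y)) *: f
    + (4%:R / 3%:R * (mu * x - E * y)) *: w + gamma *: c.
  have zc : (4%:R / 3%:R * (mu * x - E * y)) *: (x *: m + y *: e)
      + gamma *: c = mu *: m - E *: e.
    rewrite /c /gamma; apply/rowP => j; rewrite !mxE.
    apply/eqP; rewrite -subr_eq0; apply/eqP.
    transitivity (4%:R / 3%:R * (x ^+ 2 + y ^+ 2 - 3%:R / 4%:R)
      * (mu * m ord0 j - E * e ord0 j)); first by field.
    by rewrite y2; field.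
  have -> : w = 2%:R^-1 *: f + (x *: m + y *: e) by rewrite addrA.
  rewrite {1}uE addrAC -zc; apply/rowP => j; rewrite !mxE; by field.
rewrite uE' !(dotDl _ _ (q + _ + _)) !(dotZl _ _ (q + _ + _)) fS wS cS !mulr0 !add0r.
rewrite mulr_gt0 //.
  (* The term [E * x] dominates: [(mu * y) ^+ 2] is at most [3/16 * x ^+ 2], while
     [E ^+ 2 > 1/2]. *)
  rewrite /gamma mulr_gt0 ?divr_gt0 // addrC; apply: sqr_lt_pos.
    by rewrite mulr_gt0.
  rewrite !exprMn y2 E2.
  have X0 : 0 < x ^+ 2 by rewrite exprn_gt0.
  have h1 : mu ^+ 2 * (3%:R / 4%:R - x ^+ 2) <= x ^+ 2 / 4%:R * (3%:R / 4%:R).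
    by apply: ler_pM => //; [exact: sqr_ge0|lra|lra].
  apply: (le_lt_trans h1).
  have h2 : x ^+ 2 * 2%:R^-1 <= x ^+ 2 * (dot u u - mu ^+ 2 - phi ^+ 2).
    by rewrite ler_pM2l //; lra.
  by rewrite [X in _ < X]mulrC; apply: lt_le_trans h2; lra.
(* Here [dot c q >= y / 2 - x], which is positive because [x ^+ 2 <= 1/12] and [y ^+ 2 >= 2/3]. *)
rewrite mulr_gt0 // /c dotDl dotNl !dotZl.
have a1 : a < 1 by rewrite -(@ltr_pXn2r _ 2) ?nnegrE ?ltW // expr1n; lra.
have mq : 2%:R^-1 <= dot m q.
  have h : 1 <= 2%:R * (a * dot m q).
    move: pq p'q; rewrite pE p'E !dot_lin; lra.
  have mq0 : 0 < dot m q by rewrite -(pmulr_rgt0 _ a0); lra.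
  have : a * dot m q <= dot m q by rewrite ger_pMl // ltW.
  by lra.
have eq1 : dot e q <= 1.
  have := dot_CauchySchwarz e q; rewrite ee qq mulr1 => h.
  by rewrite leNgt; apply/negP => h1; nra.
have xy : x < y / 2%:R.
  by rewrite -(@ltr_pXn2r _ 2) ?nnegrE ?ltW ?divr_gt0 // exprMn y2; lra.
have : x * dot e q <= x by rewrite ger_pMr.
have : y / 2%:R <= y * dot m q by rewrite ler_pM2l.
by lra.
Qed.

End Turn.

(** * Supporting hyperplanes of the cone over a compact set *)

(* Start with a supporting hyperplane [u0] at [p] and turn it around [p], in the
   direction [w], until it is about to cut into [A]. It then either contains a
   second point of [A] or is approached by points of [A] tangentially. Two
   directions [j] and [k] apart from the pole are needed, whence [2 <= n]. *)
Lemma exists_support (R : realType) (n : nat) (A : set 'rV[R]_n.+1) (q1 q2 : 'rV[R]_n.+1) :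
  (2 <= n)%N -> compact A -> (forall q, A q -> dot q q = 1 /\ 0 < q ord0 ord0) ->
  A q1 -> A q2 -> q1 != q2 ->
  exists p p' u, [/\ A p, A p' & p != p'] /\
    [/\ dot u p = 0, forall q, A q -> dot u q <= 0, 1 <= dot u u &
        dot u p' ^+ 2 <= (1 - dot p p') / 8%:R].
Proof.
move=> n2 cA A1 Aq1 Aq2 q12.
have Aneq0 q : A q -> q ord0 ord0 != 0 by move=> /A1[_ /lt0r_neq0].
(* Coordinates of the central projection to the plane where the pole coordinate is 1; on unit
   vectors with positive pole coordinate they are injective. *)
pose ratio (i : 'I_n.+1) (q : 'rV[R]_n.+1) := q ord0 i / q ord0 ord0.
have [j j0 jq12] : exists2 j, j != ord0 & ratio j q1 != ratio j q2.
  apply: contrapT => noj.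
  have rE j : ratio j q1 = ratio j q2.
    have [->|j0] := eqVneq j ord0; first by rewrite /ratio !divff ?Aneq0.
    by apply/eqP/negPn/negP => rj; apply: noj; exists j.
  pose l := q2 ord0 ord0 / q1 ord0 ord0.
  have q2E : q2 = l *: q1.
    apply/rowP => j; have := rE j; rewrite /ratio /l mxE => rEj.
    rewrite mulrAC -mulrA rEj mulrC divfK ?Aneq0 //.
  have [_ q10] := A1 _ Aq1; have [_ q20] := A1 _ Aq2.
  have l0 : 0 < l by rewrite divr_gt0.
  have [q11 _] := A1 _ Aq1; have [q21 _] := A1 _ Aq2.
  have l1 : l = 1.
    move: q21; rewrite q2E !dot_lin q11 mulr1 -expr2 => /eqP.
    by rewrite sqrf_eq1 => /orP[/eqP //|/eqP lN]; lra.
  by move: q12; rewrite q2E l1 scale1r eqxx.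
have [k k0 kj] : exists2 k : 'I_n.+1, k != ord0 & k != j.
  have : (2 < #|'I_n.+1|)%N by rewrite card_ord ltnS.
  rewrite (cardD1 ord0) inE /= ltnS (cardD1 j) !inE j0 /= ltnS.
  by move=> /card_gt0P[k]; rewrite !inE => /and3P[kj k0 _]; exists k.
have [p pA pmax] : exists2 p, p \in A & forall q, q \in A -> ratio k q <= ratio k p.
  apply: compact_EVT_max => //; first by exists q1.
  apply: continuous_in_subspaceT => q /set_mem qA.
  have cc (i : 'I_n.+1) : {for q, continuous (fun x : 'rV[R]_n.+1 => x ord0 i)}.
    exact: (@coord_continuous _ _ _ ord0 i).
  exact (continuousM (cc k) (continuousV (Aneq0 _ qA) (cc ord0))).
move/set_mem: pA => pA.
have [_ p0] := A1 _ pA.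
have pn0 := Aneq0 _ pA.
pose d (i : 'I_n.+1) : 'rV[R]_n.+1 := delta_mx ord0 i.
pose u0 := d k - ratio k p *: d ord0.
have u0E q : dot u0 q = q ord0 k - ratio k p * q ord0 ord0.
  by rewrite !dot_lin !dot_delta.
have u0A q : A q -> dot u0 q <= 0.
  move=> qA; have [_ q0] := A1 _ qA.
  by rewrite u0E subr_le0 -ler_pdivrMr //; apply/pmax/mem_set.
have u0p : dot u0 p = 0 by rewrite u0E divfK ?subrr.
(* [w0] vanishes at [p] and has no [k]-coordinate, so adding multiples of it to [u0] keeps the
   [k]-coordinate 1 and thus the squared length at least 1. *)
pose w0 := d j - ratio j p *: d ord0.
have w0E q : dot w0 q = q ord0 j - ratio j p * q ord0 ord0.
  by rewrite !dot_lin !dot_delta.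
have w0p : dot w0 p = 0 by rewrite w0E divfK ?subrr.
have [q3 Aq3 wq3] : exists2 q, A q & dot w0 q != 0.
  have [e1|e1] := eqVneq (dot w0 q1) 0; last by exists q1.
  exists q2 => //; apply: contraNneq jq12 => e2.
  suff E q : A q -> dot w0 q = 0 -> ratio j q = ratio j p by rewrite !E.
  move=> qA; rewrite w0E => /eqP; rewrite subr_eq0 => /eqP.
  by move=> h; rewrite [LHS]/ratio h mulfK ?Aneq0.
have w0k : w0 ord0 k = 0.
  by rewrite !mxE !eqxx (negbTE kj) (negbTE k0) /= mulr0 subr0.
have u0k : u0 ord0 k = 1.
  by rewrite !mxE !eqxx (negbTE k0) /= mulr0 subr0.
clearbody w0.
have [w [wp wk [q' [Aq' wq']]]] : exists w : 'rV[R]_n.+1, [/\ dot w p = 0, w ord0 k = 0 &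
    exists q, A q /\ 0 < dot w q].
  have [lt|gt|eq0] := ltgtP (dot w0 q3) 0.
  - exists (- w0); split; [by rewrite dot_lin w0p oppr0|by rewrite mxE w0k oppr0|].
    by exists q3; rewrite dot_lin oppr_gt0.
  - by exists w0; split => //; exists q3.
  - by rewrite eq0 eqxx in wq3.
clearbody u0.
(* The amounts [x] of turning at which [u0 + x *: w] vanishes at some point of [A] on the positive
   side of [w]. *)
pose S := [set x | exists q, [/\ A q, 0 < dot w q & x = - dot u0 q / dot w q]].
have S0 x : S x -> 0 <= x.
  move=> [q [qA wq ->]]; rewrite divr_ge0 ?(ltW wq) //.
  by rewrite oppr_ge0 u0A.
have hasinfS : has_inf S.
  split; first by exists (- dot u0 q' / dot w q'), q'.
  by exists 0 => x /S0.
pose t := inf S.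
have t0 : 0 <= t by apply: lb_le_inf; [case: hasinfS|move=> x /S0].
have ww : 0 < dot w w.
  rewrite lt_def dotxx_ge0 andbT; apply: contraTneq wq' => /dotxx_eq0 ->.
  by rewrite /dot mul0mx mxE ltxx.
(* As [dot w p = 0], Cauchy-Schwarz for [w] and [p' - p] bounds [(eps * dot w p') ^+ 2] by
   [(2 - 2 * dot p p') / 16], the bound required. *)
pose eps := Num.sqrt (16%:R * dot w w)^-1.
have eps2 : eps ^+ 2 * dot w w = 16%:R^-1.
  rewrite sqr_sqrtr; first by field; exact: lt0r_neq0.
  by rewrite invr_ge0 mulr_ge0 ?dotxx_ge0.
have eps0 : 0 < eps by rewrite sqrtr_gt0 invr_gt0 mulr_gt0.
have [_ [p' [Ap' wp' ->]] tp'] := inf_adherent eps0 hasinfS.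
have uA q : A q -> dot (u0 + t *: w) q <= 0.
  move=> qA; rewrite !dot_lin.
  have [wq|wq] := leP (dot w q) 0.
    by rewrite -(addr0 0) lerD ?u0A // mulr_ge0_le0.
  have : t <= - dot u0 q / dot w q.
    by apply: ge_inf; [case: hasinfS|exists q].
  by rewrite ler_pdivlMr //; lra.
exists p, p', (u0 + t *: w); split; split => //.
- by apply: contraTneq wp' => <-; rewrite wp ltxx.
- by rewrite !dot_lin u0p wp mulr0 addr0.
- by apply: le_trans (sqr_coord_le _ k); rewrite !mxE u0k wk mulr0 addr0 expr1n.
have h0 := uA _ Ap'.
have h1 : - dot (u0 + t *: w) p' < eps * dot w p'.
  by move: tp'; rewrite ltr_pdivrMr // -/t !dot_lin; lra.
have h2 : dot (u0 + t *: w) p' ^+ 2 <= (eps * dot w p') ^+ 2.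
  rewrite -[X in X <= _]sqrrN; apply: lerXn2r (ltW h1); rewrite nnegrE.
    by rewrite oppr_ge0.
  by rewrite ltW // mulr_gt0.
apply: (le_trans h2); rewrite exprMn.
have [[pp _] [p'p' _]] := (A1 _ pA, A1 _ Ap').
have h3 : dot w p' ^+ 2 <= dot w w * (2%:R - 2%:R * dot p p').
  have := dot_CauchySchwarz w (p' - p); rewrite !dot_lin wp pp p'p' (dotC p' p).
  by rewrite subr0; congr (_ <= _ * _); ring.
have h4 := ler_wpM2l (sqr_ge0 eps) h3.
apply: (le_trans h4); rewrite mulrA eps2; lra.
Qed.

(** * Topology of the sphere and its caps *)

Section SphTopology.
Context {R : realType} {n : nat}.
Notation S := (Sph R n).

Lemma sph_dot (x : S) : dot (set_val x) (set_val x) = 1.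
Proof. by rewrite dotxx; have := set_valP x. Qed.

Lemma sph_exists (v : 'rV[R]_n.+1) : dot v v = 1 -> exists x : S, set_val x = v.
Proof.
rewrite dotxx => v1; have vS : v \in sphere R n by apply/mem_set.
by exists (SigSub vS).
Qed.

Lemma sph_val_inj (x y : S) : set_val x = set_val y -> x = y.
Proof. exact: val_inj. Qed.

Lemma continuous_dot (T : topologicalType) (f g : T -> 'rV[R]_n.+1) :
  continuous f -> continuous g -> continuous (fun t => dot (f t) (g t)).
Proof.
move=> cf cg.
have -> : (fun t => dot (f t) (g t)) = (fun t => \sum_(i < n.+1) f t ord0 i * g t ord0 i).
  by apply/funext => t; rewrite dotE.
apply: (@continuous_big R _ +%R 0 xpredT add_continuous) => i _ t.
have cc : continuous (fun v : 'rV[R]_n.+1 => v ord0 i) by exact: coord_continuous.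
exact (continuousM (continuous_comp (cf t) (cc _)) (continuous_comp (cg t) (cc _))).
Qed.

Lemma set_val_continuous : continuous (set_val : S -> 'rV[R]_n.+1).
Proof. exact: initial_continuous. Qed.

Lemma sph_dot_continuous (c : 'rV[R]_n.+1) :
  continuous (fun x : S => dot c (set_val x)).
Proof.
by apply: continuous_dot; [move=> x; exact: cst_continuous|exact: set_val_continuous].
Qed.

Lemma sphere_compact : compact (sphere R n).
Proof.
have cube : compact [set v : 'rV[R]_n.+1 | forall i, `[(-1), 1]%classic (v ord0 i)].
  exact (@rV_compact R n.+1 (fun=> `[(-1), 1]%classic) (fun=> @segment_compact R (-1) 1)).
apply: subclosed_compact cube _.
  have -> : sphere R n = (fun v : 'rV[R]_n.+1 => dot v v) @^-1` [set 1].
    by apply/seteqP; split => v; rewrite /= dotxx.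
  apply: closed_comp; last exact: closed_eq.
  by move=> v _; apply: continuous_dot => w; exact: cvg_id.
move=> v /= v1 i; have := sqr_coord_le v i; rewrite dotxx v1 in_itv /=.
by set a := v ord0 i => a1; apply/andP; split; nra.
Qed.

Lemma sph_nbhs (x : S) (U : set S) : nbhs x U ->
  exists2 W : set 'rV[R]_n.+1, nbhs (set_val x) W & set_val @^-1` W `<=` U.
Proof.
move=> [_ [[W oW <-] Wx] WU]; exists W => //.
exact: open_nbhs_nbhs.
Qed.

(** The image filter clusters at a point of the sphere in the ambient space, and this point lifts
    back to [S]. *)
Lemma sph_compact : compact [set: S].
Proof.
move=> F FF _.
have FS : (set_val @ F) (sphere R n).
  by rewrite /fmap /=; apply: filterS filterT => x _; exact: set_valP.
have [v [vS clv]] := sphere_compact (set_val @ F) _ FS.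
have vv : dot v v = 1 by rewrite dotxx.
have [x xv] := sph_exists v vv.
exists x; split => // A B FA /sph_nbhs[W Wx WB].
rewrite xv in Wx.
have FA' : (set_val @ F) (set_val @` A) by rewrite /fmap /=; apply: filterS FA => y Ay; exists y.
have [y [[a Aa <-] Wa]] := clv _ _ FA' Wx.
by exists a; split => //; exact: WB.
Qed.

Definition cap (c : 'rV[R]_n.+1) (t : R) : set S := [set x | t <= dot c (set_val x)].

Lemma cap_closed (c : 'rV[R]_n.+1) (t : R) :
  closed (cap c t).
Proof.
apply: (@closed_comp S R (fun x => dot c (set_val x)) [set y | t <= y]).
  by move=> x _; exact: sph_dot_continuous.
exact: closed_ge.
Qed.

Lemma open_cap_open (c : 'rV[R]_n.+1) (t : R) :
  open [set x : S | t < dot c (set_val x)].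
Proof.
apply: (@open_comp S R (fun x => dot c (set_val x)) [set y | t < y]).
  by move=> x _; exact: sph_dot_continuous.
exact: open_gt.
Qed.

Lemma closed_val_compact (F : set S) : closed F -> compact (set_val @` F).
Proof.
move=> cF; apply: continuous_compact.
  by apply: continuous_subspaceT; exact: set_val_continuous.
exact: subclosed_compact cF sph_compact (@subsetT _ F).
Qed.

End SphTopology.

(** * No invariant binary closed k-network for [2 <= n] *)

Section NotSupercompact.
Context {R : realType} {n : nat}.
Notation S := (Sph R n).

Let e0 : 'rV[R]_n.+1 := delta_mx ord0 ord0.

Lemma dot_isometry (G : 'M[R]_n.+1) (x y : 'rV[R]_n.+1) :
  SO R n.+1 G^T -> dot (x *m G) (y *m G) = dot x y.
Proof.
move=> [GG _]; rewrite /dot trmx_mul mulmxA -(mulmxA x).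
by rewrite -[X in X *m G^T]trmxK (mulmx1C GG) mulmx1.
Qed.

Lemma sph_imageE (G : 'M[R]_n.+1) (F : set S) (y : S) :
  sph_image R n G^T F y <-> exists2 x, F x & set_val y = set_val x *m G.
Proof. by rewrite /sph_image /lin_act trmxK. Qed.

(** The cap contains [sqrt (1 - s ^+ 2) *: e0 + s *: e1] for all small [s >= 0], because
    [sqrt (1 - s ^+ 2) >= 1 - s]. *)
Lemma cap_infinite (t : R) : (1 <= n)%N -> t < 1 ->
  ~ finite_set (cap e0 t).
Proof.
move=> n1 t1 finK.
have := finite_image (fun x : S => (set_val x) ord0 (inord 1 : 'I_n.+1)) finK.
set B := [set _ | _ in _] => finB.
have i1 : (inord 1 : 'I_n.+1) == ord0 = false.
  by apply/negbTE; rewrite -val_eqE /= inordK.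
pose e1 : 'rV[R]_n.+1 := delta_mx ord0 (inord 1).
have sub s : 0 <= s -> s <= 1 - t -> s <= 1 -> B s.
  move=> s0 st s1.
  have c0 : 0 <= 1 - s ^+ 2 by nra.
  have [x xv] : exists x : S, set_val x = Num.sqrt (1 - s ^+ 2) *: e0 + s *: e1.
    apply: sph_exists; rewrite !dot_lin !dot_delta !mxE !eqxx i1 eq_sym i1 /=.
    rewrite !mulr1 !mulr0 addr0 add0r -!expr2 sqr_sqrtr //; ring.
  exists x; last first.
    by rewrite xv !mxE !eqxx i1 /= mulr0 mulr1 add0r.
  rewrite /cap /= xv dot_delta !mxE !eqxx [_ == inord 1]eq_sym i1 /= mulr0 mulr1 addr0.
  apply: le_trans (_ : 1 - s <= _); first by lra.
  rewrite -(@ler_pXn2r _ 2) ?nnegrE ?sqrtr_ge0 ?subr_ge0 // sqr_sqrtr //; nra.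
pose d := Num.min (1 - t) 1.
have d0 : 0 < d by rewrite lt_min subr_gt0 t1 ltr01.
have := finite_preimage (f := fun k : nat => d / k.+1%:R) _ finB.
have -> : (fun k : nat => d / k.+1%:R) @^-1` B = [set: nat].
  apply/seteqP; split => // k _ /=.
  have k1 : d / k.+1%:R <= d.
    by rewrite ler_pdivrMr ?ltr0n // -[X in X <= _]mulr1 ler_pM2l // ler1n.
  apply: sub; first by rewrite divr_ge0 // ltW.
    by apply: (le_trans k1); rewrite ge_min lexx.
  by apply: (le_trans k1); rewrite ge_min lexx orbT.
move=> fin; apply: infinite_nat; apply: fin => k l _ _ /= /(mulfI (lt0r_neq0 d0)).
by move=> /invr_inj /eqP; rewrite eqr_nat eqSS => /eqP.
Qed.

(** Finitely many members of [N] cover an infinite closed cap inside a larger open one, so they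
    cannot all have at most one point. *)
Lemma knetwork_small (N : set (set S)) : (1 <= n)%N -> closed_knetwork N ->
  exists F, [/\ N F, closed F, (forall x, F x -> 9%:R / 10%:R < dot e0 (set_val x)) &
    exists x y, [/\ F x, F y & x != y]].
Proof.
move=> n1 [clN knet].
pose t : R := 19%:R / 20%:R.
pose K : set S := cap e0 t.
have KU : K `<=` [set x : S | 9%:R / 10%:R < dot e0 (set_val x)].
  by move=> x /=; rewrite /K /cap /t /=; lra.
have cK : compact K := subclosed_compact (cap_closed e0 t) sph_compact (@subsetT _ K).
have [Fm [finF FN KF FU]] := knet _ K (open_cap_open e0 (9%:R / 10%:R)) cK KU.
apply: contrapT => noF; apply: (cap_infinite t n1); first by rewrite /t; lra.
apply: sub_finite_set KF _; apply: bigcup_finite => // F FF.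
have [[x Fx]|F0] := pselect (F !=set0); last first.
  by rewrite (_ : F = set0) //; apply/seteqP; split => // x Fx; case: F0; exists x.
apply: (@sub_finite_set _ _ [set x]) => // y Fy /=.
apply/eqP; rewrite eq_sym; apply/negPn/negP => xy; apply: noF; exists F; split.
- exact: FN.
- exact: clN (FN _ FF).
- by move=> z Fz; apply: FU; exists F.
- by exists x, y.
Qed.

Lemma not_SO_supercompact : (2 <= n)%N -> ~ SO_supercompact R n.
Proof.
move=> n2 [N [invN binN netN]].
have [F [NF clF Fe [x [y [Fx Fy xy]]]]] := knetwork_small N (ltnW n2) netN.
have F_dot a b : F a -> F b -> 2%:R^-1 <= dot (set_val a) (set_val b).
  move=> /Fe ea /Fe eb.
  (* Expanding gives [dot a b >= 2 * (dot e0 a + dot e0 b) - 3 > 3/5]. *)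
  have := dotxx_ge0 (set_val a + set_val b - 2%:R *: e0).
  rewrite !dot_lin !sph_dot (dotC (set_val b) (set_val a)).
  rewrite (dotC (set_val a) e0) (dotC (set_val b) e0).
  have : dot e0 e0 = 1 by rewrite dot_delta !mxE !eqxx.
  lra.
have [p [p' [u [[]]]]] : exists p p' u, [/\ (set_val @` F) p, (set_val @` F) p' & p != p'] /\
    [/\ dot u p = 0, forall q, (set_val @` F) q -> dot u q <= 0, 1 <= dot u u &
        dot u p' ^+ 2 <= (1 - dot p p') / 8%:R].
  apply: (@exists_support _ _ _ (set_val x) (set_val y) n2).
  - exact: closed_val_compact.
  - move=> _ [a Fa <-]; rewrite sph_dot -dot_delta; split => //.
    by apply: lt_trans (Fe _ Fa); lra.
  - by exists x.
  - by exists y.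
  - by apply: contraNneq xy => /sph_val_inj ->.
move=> [P FP <-] [P' FP' <-] PP' [uP uF uu uP'].
have [G [SOG G3 PG sum]] := triangle_rotation (set_val P) (set_val P') u
  (sph_dot P) (sph_dot P') PP' (F_dot _ _ FP FP') uP uP' uu.
have rot3 v : v *m G *m G *m G = v by rewrite -!mulmxA (mulmxA G) G3 mulmx1.
pose g := sph_image R n G^T.
have NgF : N (g F) by apply: invN.
have NggF : N (g (g F)) by apply: invN.
(* With [P' = P G], the sets [F], [g F], [g (g F)] meet pairwise in [P'], in [P' G] and in
   [P = P' G^2]. *)
have [gP' gP'E] : exists z : S, set_val z = set_val P' *m G.
  by apply: sph_exists; rewrite dot_isometry // sph_dot.
have gFP' : g F P' by apply/sph_imageE; exists P.
have gFgP' : g F gP' by apply/sph_imageE; exists P'.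
have ggFgP' : g (g F) gP' by apply/sph_imageE; exists P'.
have ggFP : g (g F) P.
  by apply/sph_imageE; exists gP' => //; rewrite gP'E -PG rot3.
have [|||q qL] := binN [set F; g F; g (g F)] _ _ [set F; g F; g (g F)] _ (@subset_refl _ _).
- by move=> A [[->|->]|->].
- by move=> A B [[->|->]|->] [[->|->]|->];
    [exists P|exists P'|exists P|exists P'|exists P'|exists gP'|exists P|exists gP'|exists gP'].
- exact: finite_set3.
(* Since [G^3 = 1], the points [q], [q G = s'] and [q G^2 = r] all lie in [F], where [u] is
   nonpositive; their sum contradicts [sum]. *)
have Fq : F q by apply: qL; left; left.
have /sph_imageE[r Fr qr] : g F q by apply: qL; left; right.
have /sph_imageE[s /sph_imageE[s' Fs' ss'] qs] : g (g F) q by apply: qL; right.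
have := sum (set_val q) (sph_dot q) (F_dot _ _ FP Fq) (F_dot _ _ FP' Fq).
have -> : set_val q *m G *m G = set_val r.
  by rewrite qr rot3.
have -> : set_val q *m G = set_val s'.
  by rewrite qs ss' rot3.
have uS z : F z -> dot u (set_val z) <= 0 by move=> Fz; apply: uF; exists z.
have := uS _ Fq; have := uS _ Fs'; have := uS _ Fr.
by rewrite !(dotDr u); lra.
Qed.
End NotSupercompact.

(** * Helly's theorem for an order, and the order on a half-circle *)

Lemma finite_min (R : realType) (A : set R) :
  finite_set A -> A !=set0 -> exists2 a, A a & forall b, A b -> a <= b.
Proof.
move=> /finite_seqP[s ->]; elim: s => [[x]|x s IH _] //=.
have [sx|s0] := pselect ([set` s] !=set0).
  have [a sa amin] := IH sx; have [xa|ax] := leP x a.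
    exists x; rewrite /= ?inE ?eqxx // => b; rewrite /= inE => /orP[/eqP-> //|bs].
    exact: le_trans xa (amin _ bs).
  exists a; first by rewrite /= inE sa orbT.
  by move=> b; rewrite /= inE => /orP[/eqP ->|/amin //]; exact: ltW.
exists x; rewrite /= ?inE ?eqxx // => b; rewrite /= inE => /orP[/eqP-> //|bs].
by case: s0; exists b.
Qed.

(* The common point is the largest of the smallest [tau]-values of the chosen
   points [m (A, B)] of [A `&` B]. *)
Lemma Helly (T : Type) (R : realType) (tau : T -> R) (F : set (set T)) :
  finite_set F -> F !=set0 -> linked F ->
  (forall A B x y z, F A -> F B -> A x -> B y -> A z -> tau x <= tau y <= tau z -> A y) ->
  \bigcap_(A in F) A !=set0.
Proof.
move=> finF F0 linkF convF.
have /choice[m mP] (AB : set T * set T) :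
    exists x, F AB.1 -> F AB.2 -> (AB.1 `&` AB.2) x.
  case: AB => A B /=; have [[FA FB]|nFAB] := pselect (F A /\ F B).
    by have [x ABx] := linkF _ _ FA FB; exists x.
  have [C FC] := F0; have [x _] := linkF _ _ FC FC.
  by exists x => FA FB; case: nFAB.
have /choice[l lP] (A : set T) :
    exists C, F C /\ forall B, F B -> tau (m (A, C)) <= tau (m (A, B)).
  have [||_ [C FC <-] Cmin] := @finite_min R ((fun B => tau (m (A, B))) @` F).
  - exact: finite_image.
  - by case: F0 => C FC; exists (tau (m (A, C))), C.
  by exists C; split => // B FB; apply: Cmin; exists B.
have [||_ [A FA <-] Amax] := @finite_min R ((fun A => - tau (m (A, l A))) @` F).
- exact: finite_image.
- by case: F0 => C FC; exists (- tau (m (C, l C))), C.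
have [FlA lA] := lP A; have [Am _] := mP (A, l A) FA FlA.
exists (m (A, l A)) => B FB.
have [FlB lB] := lP B; have [Bm _] := mP (B, l B) FB FlB.
have [_ Bm'] := mP (A, B) FA FB.
(* The candidate lies in [A], and [B] has the point [m (B, l B)] below it and [m (A, B)] above
   it. *)
apply: (convF B A _ _ _ FB FA Bm Am Bm'); rewrite lA // andbT.
by rewrite -lerN2; apply: Amax; exists B.
Qed.

(** This is the triangle inequality. It makes small caps convex: a point between two points of a cap
    of positive height keeps that height. *)
Lemma between_le1 (R : realType) (n : nat) (x y z : 'rV[R]_n) (a b : R) :
  dot x x = 1 -> dot y y = 1 -> dot z z = 1 -> 0 <= a -> 0 <= b ->
  y = a *: x + b *: z -> 1 <= a + b.
Proof.
move=> x1 y1 z1 a0 b0 yE.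
have xz : dot x z <= 1 by have := dotxx_ge0 (x - z); rewrite !dot_lin x1 z1 (dotC z x); lra.
have : a * b * dot x z <= a * b * 1 by rewrite ler_wpM2l ?mulr_ge0.
have := y1; rewrite yE !dot_lin x1 z1 (dotC z x) => ab1 abxz.
rewrite leNgt; apply/negP => ab.
have : (a + b) ^+ 2 < 1 by rewrite expr_lt1 ?addr_ge0.
by lra.

Qed.

Lemma half_circle_order (R : realType) (n : nat) (c : 'rV[R]_n.+1) :
  (n <= 1)%N -> dot c c = 1 -> exists tau : 'rV[R]_n.+1 -> R,
  forall x y z, dot x x = 1 -> dot y y = 1 -> dot z z = 1 ->
    0 < dot c x -> 0 < dot c y -> 0 < dot c z -> tau x <= tau y <= tau z ->
    exists a b, [/\ 0 <= a, 0 <= b & y = a *: x + b *: z].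
Proof.
case: n c => [|[|//]] c _ c1.
  (* For [n = 0] the open half of the two-point sphere is the single point [c], so a constant [tau]
     works. *)
  move: c1; rewrite dotE big_ord1 => c1.
  have E z : dot z z = 1 -> 0 < dot c z -> z ord0 ord0 = c ord0 ord0.
    rewrite !dotE !big_ord1 => z1 cz.
    have : (c ord0 ord0 * z ord0 ord0) ^+ 2 == 1 by rewrite exprMn !expr2 c1 z1 mulr1.
    rewrite sqrf_eq1 => /orP[/eqP cz1|/eqP czN]; last lra.
    by rewrite -[LHS]mul1r -c1 -mulrA cz1 mulr1.
  exists (fun=> 0) => x y z x1 y1 _ cx cy _ _.
  exists 1, 0; split => //; apply/rowP => i.
  by rewrite ord1 !mxE mul1r mul0r addr0 (E y) // (E x).
pose cross (x y : 'rV[R]_2) := x ord0 ord0 * y ord0 ord_max - x ord0 ord_max * y ord0 ord0.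
have dot2 (x y : 'rV[R]_2) :
    dot x y = x ord0 ord0 * y ord0 ord0 + x ord0 ord_max * y ord0 ord_max.
  by rewrite dotE big_ord_recl big_ord1; congr (_ + _ * _); congr (_ _ _); apply: val_inj.
have lagrange x y : dot x y ^+ 2 + cross x y ^+ 2 = dot x x * dot y y.
  by rewrite !dot2 /cross; ring.
(* The tangent of the signed angle from [c], increasing along the open half-circle. *)
exists (fun x => cross c x / dot c x).
have crossE x y : 0 < dot c x -> 0 < dot c y ->
    cross c x / dot c x <= cross c y / dot c y -> 0 <= cross x y.
  move=> cx cy; rewrite ler_pdivrMr // mulrAC ler_pdivlMr // -subr_ge0.
  suff -> : cross c y * dot c x - cross c x * dot c y = cross x y * dot c c.
    by rewrite c1 mulr1.
  by rewrite !dot2 /cross; ring.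
have cross0 x y : dot x x = 1 -> dot y y = 1 -> 0 < dot c x -> 0 < dot c y ->
    cross x y = 0 -> x = y.
  move=> x1 y1 cx cy xy0; have := lagrange x y.
  rewrite xy0 expr0n addr0 x1 y1 mulr1 => /eqP; rewrite sqrf_eq1.
  move=> /orP[/eqP xy|/eqP xy]; first by apply: dot_eq1; rewrite // xy.
  have xNy : x = - y by apply: dot_eq1; rewrite ?dot_lin ?opprK // xy opprK.
  by move: cx; rewrite xNy dotNr oppr_gt0 => /(lt_trans cy); rewrite ltxx.
move=> x y z x1 y1 z1 cx cy cz /andP[xy yz].
have xz := le_trans xy yz.
have {xy yz xz} [xy yz xz] : [/\ 0 <= cross x y, 0 <= cross y z & 0 <= cross x z].
  by split; apply: crossE.
(* If the ends coincide, then [cross x y] is both nonnegative and nonpositive, so [y] coincides with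
   them. *)
have [xz0|xz0] := eqVneq (cross x z) 0.
  exists 1, 0; split=> //; rewrite scale1r scale0r addr0; apply/esym/cross0 => //.
  have := yz; rewrite -(cross0 x z) // /cross; move: xy; rewrite /cross; lra.
have D0 : 0 < cross x z by rewrite lt_def xz0.
exists (cross y z / cross x z), (cross x y / cross x z); split.
- by rewrite divr_ge0.
- by rewrite divr_ge0.
(* Cramer's rule in the plane. *)
have yD : cross x z *: y = cross y z *: x + cross x y *: z.
  apply/rowP => i; have [->|->] : i = ord0 \/ i = ord_max.
  - by case: i => [[|[|//]] hi]; [left|right]; apply: val_inj.
  - by rewrite !mxE /cross; ring.
  - by rewrite !mxE /cross; ring.
rewrite ![_ / cross x z]mulrC -!scalerA -scalerDr -yD scalerA mulVf // scale1r //.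
Qed.

(** * The network of small caps *)

Section Caps.
Context {R : realType} {n : nat}.
Notation S := (Sph R n).

(* Radius at most arccos 0.9 < 30 degrees: all points of the caps meeting a cap
   with centre [c] lie in the open hemisphere around [c]. *)
Definition caps : set (set S) :=
  [set F | exists c t, [/\ dot c c = 1, 9%:R / 10%:R <= t & F = cap c t]].

Lemma caps_SO_invariant : SO_invariant R n caps.
Proof.
move=> M _ [MM M1] [c [t [c1 t9 ->]]].
have dotM (x y : 'rV[R]_n.+1) : dot (x *m M^T) (y *m M^T) = dot x y.
  by rewrite /dot trmx_mul trmxK mulmxA -(mulmxA x) (mulmx1C MM) mulmx1.
exists (c *m M^T), t; rewrite dotM; split => //.
apply/seteqP; split => y.
  by move=> [x xc yE]; rewrite /cap /= yE /lin_act dotM.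
rewrite /cap /= => yc.
have [x xE] : exists x : S, set_val x = set_val y *m M.
  by apply: sph_exists; rewrite -dotM -!mulmxA MM mulmx1 sph_dot.
exists x; last by rewrite /lin_act xE -mulmxA MM mulmx1.
by rewrite /cap /= xE -dotM -!mulmxA MM mulmx1.
Qed.

Lemma caps_nbhs (x : S) (U : set S) : nbhs x U ->
  exists t, [/\ 9%:R / 10%:R <= t, t < 1 & cap (set_val x) t `<=` U].
Proof.
move=> /sph_nbhs[W /nbhs_ballP[r /= r0 rW] WU].
(* Unit vectors have squared distance [2 - 2 * dot x y], so the second threshold bounds it by
   [r ^+ 2 / 2]. *)
exists (Num.max (9%:R / 10%:R) (1 - r ^+ 2 / 4%:R)); split.
- by rewrite le_max lexx.
- by rewrite gt_max; apply/andP; split; [lra|have := exprn_gt0 2 r0; lra].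
move=> y; rewrite /cap /= ge_max => /andP[_ xy].
apply: WU; apply: rW; split=> // i j; rewrite ord1 {i}.
have := sqr_coord_le (set_val x - set_val y) j.
rewrite !dot_lin !sph_dot (dotC (set_val y) (set_val x)) !mxE => h.
rewrite /ball /=; set d := _ - _ in h *.
have dr : d ^+ 2 < r ^+ 2 by have := exprn_gt0 2 r0; lra.
have := sqr_lt_pos r d r0 dr; have := sqr_lt_pos r (- d) r0.
by rewrite sqrrN ltr_norml => /(_ dr) ? ?; apply/andP; split; lra.
Qed.

(** Around each point of [K] take a closed cap inside [U]; the open caps of the same heights cover
    [K], and a finite subcover suffices. *)
Lemma caps_closed_knetwork : closed_knetwork caps.
Proof.
split=> [_ [c [t [_ _ ->]]]|U K oU cK KU]; first exact: cap_closed.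
have [e _] : exists x : S, set_val x = delta_mx ord0 ord0.
  by apply: sph_exists; rewrite dot_delta !mxE !eqxx.
(* [compact_cover] is stated for pointed spaces only. *)
pose T : ptopologicalType :=
  HB.pack (Topological.sort S) (Topological.class S) (isPointed.Build (Topological.sort S) e).
have /choice[t tP] (x : S) : exists t : R, K x ->
    [/\ 9%:R / 10%:R <= t, t < 1 & cap (set_val x) t `<=` U].
  have [Kx|nKx] := pselect (K x); last by exists 0.
  have [t] := caps_nbhs x U (open_nbhs_nbhs (conj oU (KU _ Kx))).
  by exists t.
have : cover_compact (K : set T) by rewrite -compact_cover.
move=> /(_ S K (fun x => [set y : S | t x < dot (set_val x) (set_val y)])) [].
- by move=> x _; exact: open_cap_open.
- by move=> x Kx; exists x => //=; rewrite sph_dot; case: (tP _ Kx).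
move=> D DK KD.
have DK' (x : S) : [set` D] x -> K x by move=> /DK /set_mem.
exists ((fun x => cap (set_val x) (t x)) @` [set` D]); split.
- by apply: finite_image; exact: finite_fset.
- by move=> _ [x /DK' /tP[t9 _ _] <-]; exists (set_val x), (t x); rewrite sph_dot.
- move=> x /KD [y /= Dy yx]; exists (cap (set_val y) (t y)); first by exists y.
  exact: ltW.
- by move=> x [_ [y /DK' /tP[_ _ yU] <-] yx]; exact: yU.
Qed.

Lemma caps_binary : (n <= 1)%N -> binary caps.
Proof.
move=> n1 L Lcaps linkL F finF FL.
have [[B FB]|F0] := pselect (F !=set0); last first.
  have [x _] : exists x : S, set_val x = delta_mx ord0 ord0.
    by apply: sph_exists; rewrite dot_delta !mxE !eqxx.
  by exists x => A FA; case: F0; exists A.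
have [c [s [c1 s9 BE]]] := Lcaps _ (FL _ FB).
have FcP A x : F A -> A x -> 0 < dot c (set_val x).
  move=> FA Ax; have [c' [t [c'1 t9 AE]]] := Lcaps _ (FL _ FA).
  have [p [Ap Bp]] := linkL _ _ (FL _ FA) (FL _ FB).
  move: Ap Bp Ax; rewrite AE BE /cap /= => Ap Bp Ax.
  have p1 := sph_dot p; have x1 := sph_dot x.
  move: (set_val p) (set_val x) p1 x1 Ap Bp Ax => p' x' p1 x1 Ap Bp Ax.
  (* The chords [c - p'], [p' - c'], [c' - x'] have squared lengths at most 1/5. These three
     inequalities bound the square of their sum by three times the sum of squares, so
     [2 - 2 * dot c x' <= 9/5]. *)
  have := dotxx_ge0 ((c - p') - (p' - c')).
  have := dotxx_ge0 ((p' - c') - (c' - x')).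
  have := dotxx_ge0 ((c - p') - (c' - x')).
  rewrite !dot_lin c1 c'1 p1 x1 (dotC p' c) (dotC c' c) (dotC x' c) (dotC p' c').
  rewrite (dotC x' p') (dotC x' c'); lra.
have [tau tauP] := half_circle_order _ _ c n1 c1.
apply: (@Helly _ R (tau \o set_val)) => //; first by exists B.
  by move=> A A' FA FA'; apply: linkL; apply: FL.
move=> A A' x y z FA FA' Ax A'y Az xyz.
(* Membership of [y] in [A'] is what places it in the hemisphere around [c]. *)
have [a [b [a0 b0 yE]]] := tauP _ _ _ (sph_dot x) (sph_dot y) (sph_dot z)
  (FcP _ _ FA Ax) (FcP _ _ FA' A'y) (FcP _ _ FA Az) xyz.
have ab := between_le1 _ _ _ _ _ _ _ (sph_dot x) (sph_dot y) (sph_dot z) a0 b0 yE.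
(* The height of [y] over [c'] is at least [(a + b) * t], hence at least [t]. *)
have [c' [t [c'1 t9 AE]]] := Lcaps _ (FL _ FA).
move: Ax Az; rewrite AE /cap /= yE !dot_lin => Ax Az.
have := ler_wpM2l a0 Ax; have := ler_wpM2l b0 Az.
nra.
Qed.
End Caps.

Theorem theorem1p4 (R : realType) (n : nat) :
  SO_supercompact R n <-> (n <= 1)%N.
Proof.
split=> [supc|n1].
  by rewrite leqNgt; apply/negP => n2; exact: (not_SO_supercompact n2 supc).
exists caps; split.
- exact: caps_SO_invariant.
- exact: caps_binary.
- exact: caps_closed_knetwork.
Qed.
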